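(* Let $n\ge 2$ and consider forests on the node set $\{0,1,\dots,n\}$, with formal commuting edge weights $a_{ij}$ ($i\neq j$). Let $R^{NF}$ be the set $\left(R_{0,2}\times R_{0,1}\right)\setminus \left(R_{0,2}^{1\to 2}\times R_{0,1}^{2\to 1}\right)$. Then $$\sum_{(F,G)\in R_0\times R_{0,1,2}}a_Fa_G=\sum_{(F,G)\in R^{NF}}a_Fa_G.$$
   Context: All graphs are directed graphs on the labeled node set $\{0,1,\dots,n\}$, with possible edges $i\to j$ for $i\ne j$. A tree is a connected directed graph with no directed cycles in which no node has more than one edge coming out of it; its root is the node to which every other node has a directed path (the root has no out-edge). A forest is a disjoint union of trees (covering all nodes $0,\dots,n$). Equivalently, a forest is a directed graph with no directed cycles in which every node has at most one out-edge; its roots are exactly the nodes with no out-edge. For a set of nodes $U$, $R_U$ is the set of forests whose set of roots is exactly $U$ (set braces are dropped in subscripts, so $R_0=R_{\{0\}}$, $R_{0,1,2}=R_{\{0,1,2\}}$, etc.). $R_U^{i\to j}$ is the set of forests in $R_U$ in which node $i$ lies in the tree rooted at $j$, i.e. there is a directed path from $i$ to $j$. The weight of the edge $i\to j$ is a formal variable $a_{ij}$. The forest monomial $a_F$ of a forest $F$ is the product of the variables $a_{ij}$ over all edges $i\to j$ of $F$ (the empty product is $1$). *)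

(* Defs.v *)
From HB Require Import structures.
From mathcomp Require Import all_boot all_order all_algebra.
From mathcomp Require Import mpoly.
Set Implicit Arguments. Unset Strict Implicit. Unset Printing Implicit Defensive.
Import GRing.Theory.
Local Open Scope ring_scope.

Notation node n := ('I_n.+1).

(* [inord] is meaningful only for k <= n. *)
Definition nd (n k : nat) : node n := inord k.

Definition edge (n : nat) := {e : node n * node n | e.1 != e.2}.

Definition digraph (n : nat) := {set edge n}.

Definition arc n (F : digraph n) : rel (node n) :=
  fun i j => [exists e in F, val e == (i, j)].

Definition acyclic n (F : digraph n) : bool :=
  [forall i, forall j, arc F i j ==> ~~ connect (arc F) j i].

(* [cycle] holds vacuously of the empty sequence. *)
Lemma acyclicP n (F : digraph n) :
  reflect (forall c : seq (node n), cycle (arc F) c -> c = [::]) (acyclic F).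
Proof.
apply: (iffP idP) => [/forallP acF [|x c] //= cyc|noc].
  case: c cyc => [|y c] /= /andP[xy pc].
    by have /forallP/(_ x) := acF x; rewrite xy connect0.
  have /forallP/(_ y) := acF x; rewrite xy /=; case/negP.
  by apply/connectP; exists (rcons c x); rewrite ?last_rcons.
apply/forallP => i; apply/forallP => j; apply/implyP => ij.
apply/negP => /connectP[p pp ip].
have := noc (j :: p); rewrite /= rcons_path pp -ip ij => /(_ isT).
by [].
Qed.

Definition outdeg n (F : digraph n) (i : node n) : nat := #|arc F i|.

Definition forest n (F : digraph n) : bool :=
  acyclic F && [forall i, outdeg F i <= 1]%N.

Definition forest_roots n (F : digraph n) : {set node n} :=
  [set i | outdeg F i == 0%N].

Definition rooted n (U : {set node n}) : {set digraph n} :=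
  [set F | forest F & forest_roots F == U].

(* Meant for j \in U, where reaching j is lying in the tree rooted at j. *)
Definition rooted_to n (U : {set node n}) (i j : node n) : {set digraph n} :=
  [set F in rooted U | connect (arc F) i j].

Definition weight_ring (K : comNzRingType) (n : nat) : comNzRingType :=
  {mpoly K[#|{: edge n}|]}.

(* One indeterminate a_ij per ordered pair of distinct nodes. *)
Definition weight (K : comNzRingType) n (e : edge n) : weight_ring K n :=
  'X_(enum_rank e).

Definition forest_monomial (K : comNzRingType) n (F : digraph n) :
    weight_ring K n :=
  \prod_(e in F) weight K e.

Definition RNF (n : nat) : {set digraph n * digraph n} :=
  let v0 := nd n 0 in let v1 := nd n 1 in let v2 := nd n 2 in
  setX (rooted [set v0; v2]) (rooted [set v0; v1])
    :\: setX (rooted_to [set v0; v2] v1 v2) (rooted_to [set v0; v1] v2 v1).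

(* Main.v *)
Require Import Defs.
From HB Require Import structures.
From mathcomp Require Import all_boot all_order all_algebra.
From mathcomp Require Import mpoly.
From mathcomp Require Import ring.
Set Implicit Arguments. Unset Strict Implicit. Unset Printing Implicit Defensive.
Import GRing.Theory.
Local Open Scope ring_scope.

(** The identity is Dodgson condensation for the Laplacian of the complete
digraph, read through the all-minors matrix tree theorem. The proof below
replaces determinants by the potential theory of random walks.

For weights w in any commutative ring, write P U for the weighted sum of the
forests with root set U and H U t k for the part of that sum in which k lies in
the tree rooted at t. In probabilistic terms H U t k / P U is the chance that
the walk from k first meets U at t. Three facts are used.

- For j outside U, a forest rooted at U is a forest G rooted at j |: U together
  with an edge out of j whose head does not lead back to j in G. As adding this
  edge changes reachability in an explicit way, H U t is expressed through the
  forests rooted at j |: U ([forest_sum_to_cut]). Hence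
  H U t j = \sum_e w e * H (j |: U) t (dst e), over the edges e out of j
  ([forest_sum_to_out]), and H U t is harmonic off U
  ([forest_sum_to_harmonic]).

- The strong Markov property ([first_hitting]): for v outside U and t in U,
  H U t j * P (v |: U)
    = P U * H (v |: U) t j + H (v |: U) v j * H U t v.
  As functions of j both sides are harmonic off v |: U and agree on v |: U.
  Uniqueness needs some cancellation, which fails over a general ring; so the
  indeterminate 'X is added to the weight of every edge into t, a degree
  argument gives uniqueness over {poly A} ([harmonic_unique]), and 'X is then
  set to 0.

- Averaging the strong Markov property over the edges out of x and summing over
  t in U gives ([forest_sum_condensation])
  P U * P (U + x + y) = P (U + y) * P (U + x) - H (U + y) y x * H (U + x) x y.

The theorem is the case U = {0}, x = 1, y = 2 with the indeterminates as
weights. *)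

Local Notation arc := Defs.arc.

(** * Adding an edge to a digraph *)

Section Graph.
Variable n : nat.
Implicit Types (F G : digraph n) (U : {set node n}) (e : edge n) (i j k t : node n).

Definition src e : node n := (val e).1.
Definition dst e : node n := (val e).2.
Definition reach F i j : bool := connect (arc F) i j.

Lemma in_arc F i j : (j \in arc F i) = arc F i j.
Proof. by []. Qed.

Lemma arc_setU1 e G i j :
  arc (e |: G) i j = ((i == src e) && (j == dst e)) || arc G i j.
Proof.
rewrite /arc; apply/existsP/orP => [[f]|[/andP[/eqP-> /eqP->]|/existsP[f /andP[fG fv]]]].
- rewrite !inE => /andP[/orP[/eqP->|fG]] fv; last by right; apply/existsP; exists f; rewrite fG.
  by left; rewrite /src /dst (eqP fv) !eqxx.
- by exists e; rewrite setU11 /= /src /dst -surjective_pairing.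
- by exists f; rewrite inE fG orbT.
Qed.

(** Cutting a walk at its first and its last passage through e leaves two walks
that avoid e. *)
Lemma reach_setU1 e G k t :
  reach (e |: G) k t = reach G k t || (reach G k (src e) && reach G (dst e) t).
Proof.
have sub : subrel (connect (arc G)) (connect (arc (e |: G))).
  by apply: connect_sub => x y xy; apply: connect1; rewrite arc_setU1 xy orbT.
rewrite /reach; apply/idP/orP => [/connectP[p]|[/sub //|/andP[/sub ks /sub dt]]]; last first.
  apply: connect_trans ks (connect_trans _ dt).
  by apply: connect1; rewrite arc_setU1 !eqxx.
elim: p k => [|x p IH] k /=; first by move=> _ ->; left; apply: connect0.
rewrite arc_setU1 => /andP[/orP[/andP[/eqP-> /eqP->]|kx] px] tE.
  right; rewrite connect0 /=.
  by case: (IH _ px tE) => [xt|/andP[_ ->]]; rewrite // -?[x]/(dst e).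
case: (IH _ px tE) => [xt|/andP[xs dt]]; [left|right].
  exact: connect_trans (connect1 kx) xt.
by rewrite (connect_trans (connect1 kx) xs).
Qed.

Lemma acyclicE F : acyclic F = [forall e in F, ~~ reach F (dst e) (src e)].
Proof.
apply/idP/idP => [/forallP acF|/forallP acF].
  apply/forallP => e; apply/implyP => eF.
  have /forallP/(_ (dst e))/implyP := acF (src e); apply.
  by apply/existsP; exists e; rewrite eF /src /dst -surjective_pairing eqxx.
apply/forallP => i; apply/forallP => j; apply/implyP => /existsP[e /andP[eF /eqP ve]].
by have := acF e; rewrite eF /src /dst ve.
Qed.

(** A cycle created by e yields a walk from the head of e back to its tail;
cutting that walk at e makes it a walk of G. *)
Lemma acyclic_setU1 e G :
  acyclic (e |: G) = acyclic G && ~~ reach G (dst e) (src e).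
Proof.
rewrite !acyclicE; apply/forallP/andP => [ac|[/forallP acG nds] f].
  split; last first.
    by have := ac e; rewrite setU11 reach_setU1 negb_or => /andP[].
  apply/forallP => f; apply/implyP => fG.
  by have := ac f; rewrite inE fG orbT reach_setU1 negb_or => /andP[].
rewrite !inE; apply/implyP => /orP[/eqP->|fG]; rewrite reach_setU1.
  by rewrite (negbTE nds).
have := acG f; rewrite fG => /negbTE-> /=; apply/negP => /andP[ds_e de_s].
(* The edge f closes a walk in G from the head of e back to its tail. *)
case/negP: nds; apply: connect_trans de_s (connect_trans _ ds_e).
by apply: connect1; apply/existsP; exists f; rewrite fG /src /dst -surjective_pairing eqxx.
Qed.

Lemma outdeg_setU1 e G i :
  e \notin G -> outdeg (e |: G) i = ((i == src e) + outdeg G i)%N.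
Proof.
move=> eG; rewrite /outdeg; case: (i =P src e) => [->|ie] /=; last first.
  by rewrite add0n; apply: eq_card => j; rewrite !in_arc arc_setU1; case: (i =P src e) ie.
have eGd : dst e \notin arc G (src e).
  apply: contra eG => /existsP[f /andP[fG /eqP fe]].
  suff -> : e = f by [].
  by apply: val_inj; rewrite fe /src /dst -surjective_pairing.
rewrite (cardD1 (dst e)) {1}in_arc arc_setU1 !eqxx /=; congr (_ + _)%N.
apply: eq_card => j; rewrite !inE /= !in_arc arc_setU1 eqxx.
by case: (j =P dst e) => [->|//]; rewrite -in_arc (negbTE eGd).
Qed.

(** * Forests with a given root set *)

(** This form turns the addition of an edge into out-degree arithmetic. *)
Lemma rootedP F U :
  (F \in rooted U) = acyclic F && [forall i, outdeg F i == (i \notin U)].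
Proof.
rewrite inE -andbA; congr (_ && _); apply/andP/forallP => [[/forallP le1 /eqP<- i]|dF].
  by rewrite inE; have := le1 i; case: (outdeg F i) => [|[]].
split; first by apply/forallP => i; rewrite (eqP (dF i)); case: (_ \in _).
by apply/eqP/setP => i; rewrite inE (eqP (dF i)); case: (_ \in _).
Qed.

(** The bijection behind the recursion on the root set: giving the root
src e an out-edge merges its tree into another one, unless the edge points into
its own tree. *)
Lemma rooted_setU1 e G U : src e \notin U -> e \notin G ->
  (e |: G \in rooted U) = (G \in rooted (src e |: U)) && ~~ reach G (dst e) (src e).
Proof.
move=> sU eG; rewrite !rootedP acyclic_setU1 andbAC; congr (_ && _ && _).
apply: eq_forallb => i; rewrite outdeg_setU1 // !inE negb_or.
by case: (i =P src e) => [->|_]; rewrite ?sU.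
Qed.

Lemma root_edgeN F U e : F \in rooted U -> src e \in U -> e \notin F.
Proof.
rewrite rootedP => /andP[_ /forallP/(_ (src e))] dF sU; rewrite sU in dF.
apply: contraL dF => eF; rewrite -lt0n; apply/card_gt0P; exists (dst e).
by apply/existsP; exists e; rewrite eF /src /dst -surjective_pairing eqxx.
Qed.

Lemma out_edge_uniq F U j : F \in rooted U -> j \notin U ->
  exists e0, forall e, (e \in F) && (src e == j) = (e == e0).
Proof.
rewrite rootedP => /andP[_ /forallP/(_ j)] dF jU; rewrite jU in dF.
have /card1P[k kP] := dF.
have : k \in arc F j by rewrite kP inE.
case/existsP => e0 /andP[e0F /eqP e0v]; exists e0 => e; apply/andP/eqP => [[eF /eqP ej]|->].
  have : dst e \in arc F j.
    by apply/existsP; exists e; rewrite eF -ej /src /dst -surjective_pairing eqxx.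
  rewrite kP inE => /eqP ek; apply: val_inj; rewrite e0v -ej -ek /src /dst.
  by rewrite -surjective_pairing.
by rewrite e0F /src e0v.
Qed.

Lemma root_reach F U t k : F \in rooted U -> t \in U -> reach F t k = (t == k).
Proof.
rewrite rootedP => /andP[_ /forallP/(_ t)] dF tU; rewrite tU /= in dF.
apply/idP/eqP => [/connectP[[|x p] /=]|->]; [by move=> _ -> | | exact: connect0].
by move: dF; rewrite eqn0Ngt => /card_gt0P n0 /andP[tx]; case: n0; exists x.
Qed.

(** Walks are deterministic where the out-degree is at most 1, and stop at
roots. *)
Lemma reach_root_uniq F U k t t' : F \in rooted U -> t \in U -> t' \in U ->
  reach F k t -> reach F k t' -> t = t'.
Proof.
move=> FU tU t'U /connectP[p]; elim: p k => [|x p IH] k /=.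
  by move=> _ <-; rewrite (root_reach _ FU) // => /eqP.
case/andP => kx px tE /connectP[[|y q] /=].
  move=> _ t'k; have : reach F t' x by apply: connect1; rewrite t'k.
  rewrite (root_reach _ FU) // => /eqP t'x.
  by apply: (IH x) => //; rewrite -t'x; apply: connect0.
case/andP => ky qy t'E; apply: (IH x) => //.
suff -> : x = y by apply/connectP; exists q.
move: FU; rewrite rootedP => /andP[_ /forallP/(_ k)/eqP dk].
have : (outdeg F k <= 1)%N by rewrite dk; case: (_ \notin _).
by move/card_le1_eqP; apply.
Qed.

(** In an acyclic digraph the set of nodes reached shrinks strictly along each
arc, so a walk must end at a node without out-edge. *)
Lemma reach_root_ex F U k : F \in rooted U -> exists2 t, t \in U & reach F k t.
Proof.
move=> FU; move: (FU); rewrite rootedP => /andP[/forallP acF /forallP dF].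
move: {2}_.+1 (ltnSn #|connect (arc F) k|) => m; elim: m k => // m IH k.
rewrite ltnS => km; case: (boolP (k \in U)) => [kU|kU].
  by exists k => //; apply: connect0.
have := dF k; rewrite kU => /card1P[x xP].
have kx : arc F k x by have := xP x; rewrite inE eqxx.
case: (IH x) => [|t tU xt]; last by exists t => //; apply: connect_trans (connect1 kx) xt.
apply: leq_trans km; apply: proper_card; apply/properP; split.
  by apply/subsetP => y xy; apply: connect_trans (connect1 kx) xy.
exists k; first exact: connect0.
by have /forallP/(_ x)/implyP := acF k; apply.
Qed.

End Graph.

(** * Weighted sums over forests *)

Definition weight_prod (A : comNzRingType) n (w : edge n -> A) (F : digraph n) : A :=
  \prod_(e in F) w e.

Definition forest_sum (A : comNzRingType) n (w : edge n -> A) (U : {set node n}) : A :=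
  \sum_(F in rooted U) weight_prod w F.

Definition forest_sum_to (A : comNzRingType) n (w : edge n -> A) (U : {set node n})
    (t k : node n) : A :=
  \sum_(F in rooted U) (reach F k t)%:R * weight_prod w F.

Section Identities.
Variables (A : comNzRingType) (n : nat) (w : edge n -> A).
Implicit Types (F G : digraph n) (U : {set node n}) (e : edge n) (i j k t v : node n).

Local Notation P := (forest_sum w).
Local Notation H := (forest_sum_to w).
Local Notation mon := (weight_prod w).

Lemma sum_reach_root F U k : F \in rooted U ->
  \sum_(t in U) (reach F k t)%:R = 1 :> A.
Proof.
move=> FU; have [t tU kt] := reach_root_ex k FU.
rewrite (bigD1 t) //= kt big1 ?addr0 // => t' /andP[t'U t't].
case: (boolP (reach F k t')) => // kt'.
by rewrite (reach_root_uniq FU t'U tU kt' kt) eqxx in t't.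
Qed.

Lemma forest_sum_split U k : P U = \sum_(t in U) H U t k.
Proof.
rewrite exchange_big /=; apply: eq_bigr => F FU.
by rewrite -mulr_suml (sum_reach_root k FU) mul1r.
Qed.

Lemma forest_sum_to_root U t k : k \in U -> H U t k = (k == t)%:R * P U.
Proof.
move=> kU; rewrite mulr_sumr; apply: eq_bigr => F FU.
by rewrite (root_reach _ FU).
Qed.

(** Sums over forests are split along the unique edge out of the non-root
j. *)
Lemma sum_rooted_cut U j (phi : digraph n -> A) : j \notin U ->
  \sum_(F in rooted U) phi F * mon F =
  \sum_(G in rooted (j |: U)) \sum_(e | src e == j)
    w e * (~~ reach G (dst e) j)%:R * phi (e |: G) * mon G.
Proof.
move=> jU; rewrite [RHS]exchange_big /=.
transitivity (\sum_(F in rooted U) \sum_(e | (src e == j) && (e \in F)) phi F * mon F).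
  apply: eq_bigr => F FU; have [e0 e0P] := out_edge_uniq FU jU.
  by rewrite (eq_bigl (pred1 e0)) ?big_pred1_eq // => e; rewrite andbC e0P.
(* Now fix e; the forests containing e are the e |: G with G lacking e. *)
rewrite (exchange_big_dep (fun e => src e == j)) /=; last by move=> F e _ /andP[].
apply: eq_bigr => e /eqP ej; rewrite ej eqxx /=.
rewrite (reindex_onto (fun G => e |: G) (fun F => F :\ e)) /=; last first.
  by move=> F /andP[_ eF]; rewrite setD1K.
transitivity (\sum_(G in rooted (j |: U) | ~~ reach G (dst e) j) w e * phi (e |: G) * mon G).
  apply: eq_big => G.
    rewrite setU11 andbT; case: (boolP (e \in G)) => eG; last first.
      by rewrite setU1K // eqxx andbT -ej rooted_setU1 ?ej.
    transitivity false; last first.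
      symmetry; apply: contraTF eG => /andP[GU _].
      by apply: (root_edgeN GU); rewrite ej setU11.
    by apply: contraTF eG => /andP[_ /eqP<-]; rewrite !inE eqxx.
  case/andP=> _ /eqP GE; have eG : e \notin G by rewrite -GE !inE eqxx.
  by rewrite /weight_prod big_setU1 //= mulrCA mulrA.
rewrite big_mkcondr; apply: eq_bigr => G _.
by case: (reach _ _ _); rewrite ?mulr0 ?mul0r ?mulr1.
Qed.

Definition out_weight j : A := \sum_(e | src e == j) w e.

(** For G rooted at a set containing j: the weight of the ways of attaching j so
that it lands in the tree of t. *)
Definition out_weight_to G j t : A :=
  \sum_(e | src e == j) w e * (reach G (dst e) t)%:R.

(** After the edge e out of j is added to G, k reaches t if it did so in G, or if
it reached j in G and the head of e reached t. The head of e must not reach j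
in G; in the second case this is automatic, since it already reaches t. *)
Lemma forest_sum_to_cut U j t k : j \notin U -> t \in U ->
  H U t k = \sum_(G in rooted (j |: U))
    ((out_weight j - out_weight_to G j j) * (reach G k t)%:R
       + (reach G k j)%:R * out_weight_to G j t) * mon G.
Proof.
move=> jU tU; rewrite /forest_sum_to (sum_rooted_cut _ jU).
apply: eq_bigr => G GU; rewrite -mulr_suml; congr (_ * _).
have jt : j != t by apply: contraNneq jU => ->.
(* No node reaches both of the roots j and t of G. *)
have excl x : (reach G x j)%:R * (reach G x t)%:R = 0 :> A.
  case: (boolP (reach G x j)) => xj; last by rewrite mul0r.
  case: (boolP (reach G x t)) => xt; last by rewrite mulr0.
  have := reach_root_uniq GU (setU11 _ _) (setU1r _ tU) xj xt.
  by move/eqP; rewrite (negbTE jt).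
rewrite /out_weight /out_weight_to -sumrB mulr_suml mulr_sumr -big_split /=.
apply: eq_bigr => e /eqP ej; rewrite reach_setU1 ej.
have := excl (dst e); have := excl k.
case: (reach G k t); case: (reach G k j); case: (reach G (dst e) j); case: (reach G (dst e) t);
  rewrite /= ?(mulr0, mul0r, mulr1, mul1r, subr0, subrr, addr0, add0r) //.
all: by move=> /eqP + /eqP; rewrite ?oner_eq0.
Qed.

Lemma forest_sum_to_out U j t : j \notin U -> t \in U ->
  H U t j = \sum_(e | src e == j) w e * H (j |: U) t (dst e).
Proof.
move=> jU tU; rewrite (forest_sum_to_cut _ jU tU).
under [RHS]eq_bigr do rewrite mulr_sumr.
rewrite [RHS]exchange_big /=; apply: eq_bigr => G GU.
rewrite !(root_reach _ GU) ?setU11 // eqxx mul1r.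
rewrite (_ : j == t = false) ?mulr0 ?add0r; last by apply: contraNF jU => /eqP->.
by rewrite mulr_suml; apply: eq_bigr => e _; rewrite mulrA.
Qed.

(** Both sides expand over the forests G rooted at j |: U and the pairs of edges
out of j. On the left, the pairs with one edge leading to j and the other to t
contribute with both signs, and cancel by exchanging the two edges. *)
Lemma forest_sum_to_harmonic U j t : j \notin U -> t \in U ->
  \sum_(e | src e == j) w e * H U t (dst e) = out_weight j * H U t j.
Proof.
move=> jU tU; rewrite (forest_sum_to_out jU tU).
under eq_bigr do rewrite (forest_sum_to_cut _ jU tU) mulr_sumr.
under [X in _ = _ * X]eq_bigr do rewrite mulr_sumr.
rewrite exchange_big [X in _ = _ * X]exchange_big mulr_sumr /=.
apply: eq_bigr => G GU.
rewrite (eq_bigr (fun e =>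
  (w e * (reach G (dst e) t)%:R) * ((out_weight j - out_weight_to G j j) * mon G)
  + (w e * (reach G (dst e) j)%:R) * (out_weight_to G j t * mon G))); last by move=> e _; ring.
rewrite big_split /= -!mulr_suml -/(out_weight_to G j t) -/(out_weight_to G j j).
under [X in _ = _ * X]eq_bigr do rewrite mulrA.
by rewrite -mulr_suml -/(out_weight_to G j t); ring.
Qed.

End Identities.

(** * Uniqueness of harmonic functions *)

(** A generic extra rate 'X of jumping to s makes the walk transient over any
ring of coefficients. *)
Definition sink_weight (A : comNzRingType) n (w : edge n -> A) (s : node n) (e : edge n) :
    {poly A} := (w e)%:P + (dst e == s)%:R * 'X.

Lemma out_weight_sink (A : comNzRingType) n (w : edge n -> A) (s j : node n) :
  j != s -> out_weight (sink_weight w s) j = (out_weight w j)%:P + 'X.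
Proof.
move=> js; rewrite /out_weight big_split /= -rmorph_sum; congr (_ + _).
have [e0 e0E] : {e0 : edge n | val e0 = (j, s)} by exists (Sub (j, s) js).
rewrite (bigD1 e0) /=; last by rewrite /src e0E.
rewrite /dst e0E eqxx mul1r big1 ?addr0 // => e /andP[/eqP ej ee0].
case: eqP => [es|_]; last by rewrite mul0r.
case/eqP: ee0; apply: val_inj; rewrite e0E -ej -es /src.
exact: surjective_pairing.
Qed.

(** Since u vanishes at s, the equation at j reads
u j * 'X = \sum_e (w e)%:P * u (dst e) - (out_weight w j)%:P * u j.
Its right-hand side has degree at most the maximal degree of the values of u, so
a nonzero u j cannot have that degree. *)
Lemma harmonic_unique (A : comNzRingType) n (w : edge n -> A) (s : node n)
    (D : {set node n}) (u : node n -> {poly A}) :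
  s \in D -> (forall j, j \in D -> u j = 0) ->
  (forall j, j \notin D ->
     \sum_(e | src e == j) sink_weight w s e * u (dst e)
     = out_weight (sink_weight w s) j * u j) ->
  forall j, u j = 0.
Proof.
move=> sD u0 hu.
have key j : j \notin D ->
    u j * 'X = \sum_(e | src e == j) (w e)%:P * u (dst e) - (out_weight w j)%:P * u j.
  move=> jD; have := hu j jD; rewrite out_weight_sink; last by apply: contraNneq jD => ->.
  rewrite (eq_bigr (fun e => (w e)%:P * u (dst e))) => [->|e _]; first by ring.
  by rewrite mulrDl -mulrA; case: (dst e =P s) => [->|_]; rewrite ?(u0 s) // ?mul0r ?mulr0 addr0.
suff bound N : (forall j, size (u j) <= N)%N -> forall j, u j = 0.
  by apply: (bound (\max_k size (u k))) => k; apply: leq_bigmax.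
elim: N => [|N IH] hN; first by move=> i; apply/eqP; rewrite -size_poly_leq0.
apply: IH => i; case: (boolP (i \in D)) => iD; first by rewrite u0 ?size_poly0.
have [->|ui] := eqVneq (u i) 0; first by rewrite size_poly0.
rewrite -ltnS -size_mulX // key //.
have cle (c : A) (p : {poly A}) : (size p <= N.+1)%N -> (size (c%:P * p)%R <= N.+1)%N.
  by rewrite mul_polyC; apply: leq_trans; apply: size_scale_leq.
rewrite (leq_trans (size_polyD _ _)) // size_polyN geq_max cle // andbT.
by rewrite (leq_trans (size_sum _ _ _)) //; apply/bigmax_leqP => e _; apply: cle.
Qed.

(** * The strong Markov property and condensation *)

Lemma horner0_weight_prod (A : comNzRingType) n (w : edge n -> A) s (F : digraph n) :
  (weight_prod (sink_weight w s) F).[0] = weight_prod w F.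
Proof.
rewrite /weight_prod horner_prod; apply: eq_bigr => e _.
by rewrite hornerD hornerC hornerMX mulr0 addr0.
Qed.

Lemma horner0_forest_sum (A : comNzRingType) n (w : edge n -> A) s U :
  (forest_sum (sink_weight w s) U).[0] = forest_sum w U.
Proof.
by rewrite horner_sum; apply: eq_bigr => F _; rewrite horner0_weight_prod.
Qed.

Lemma horner0_forest_sum_to (A : comNzRingType) n (w : edge n -> A) s U t k :
  (forest_sum_to (sink_weight w s) U t k).[0] = forest_sum_to w U t k.
Proof.
rewrite horner_sum; apply: eq_bigr => F _.
by rewrite hornerM -polyC_natr hornerC horner0_weight_prod.
Qed.

(** To reach U at t, a walk from j either meets v |: U at t, or meets it at v and
then goes on from v to meet U at t. *)
Lemma first_hitting (A : comNzRingType) n (w : edge n -> A) (U : {set node n})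
    (v t j : node n) : v \notin U -> t \in U ->
  forest_sum_to w U t j * forest_sum w (v |: U)
  = forest_sum w U * forest_sum_to w (v |: U) t j
    + forest_sum_to w (v |: U) v j * forest_sum_to w U t v.
Proof.
move=> vU tU; set w' := sink_weight w t.
have vt : v != t by apply: contraNneq vU => ->.
pose u k := forest_sum_to w' U t k * forest_sum w' (v |: U)
  - forest_sum w' U * forest_sum_to w' (v |: U) t k
  - forest_sum_to w' (v |: U) v k * forest_sum_to w' U t v.
(* The deformed weights specialize to w at 'X = 0. *)
suff u0 : u j = 0.
  have := congr1 (horner^~ 0) u0.
  rewrite /u !(hornerD, hornerN, hornerM, horner0_forest_sum, horner0_forest_sum_to) horner0.
  by move/eqP; rewrite -addrA -opprD subr_eq0 => /eqP.
apply: (@harmonic_unique _ _ w t (v |: U)) => [|k|k]; first exact: setU1r.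
  rewrite /u => kvU; rewrite !(forest_sum_to_root _ _ kvU).
  case/setU1P: kvU => [->|kU]; first by rewrite eqxx (negbTE vt) /=; ring.
  rewrite (forest_sum_to_root _ _ kU).
  by rewrite (_ : k == v = false); [rewrite /=; ring | apply: contraNF vU => /eqP<-].
move=> kvU; have kU : k \notin U by apply: contra kvU; apply: setU1r.
have h1 := forest_sum_to_harmonic w' kU tU.
have h2 := forest_sum_to_harmonic w' kvU (setU1r v tU).
have h3 := forest_sum_to_harmonic w' kvU (setU11 v U).
transitivity (forest_sum w' (v |: U) * (out_weight w' k * forest_sum_to w' U t k)
  - forest_sum w' U * (out_weight w' k * forest_sum_to w' (v |: U) t k)
  - forest_sum_to w' U t v * (out_weight w' k * forest_sum_to w' (v |: U) v k)).
  rewrite -h1 -h2 -h3 !mulr_sumr -!sumrB; apply: eq_bigr => e _; rewrite /u -/w'; ring.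
by rewrite /u; ring.
Qed.

(** The general form of the theorem. One factor in the last product counts forests
in which x hangs below y, the other one forests in which y hangs below x. *)
Lemma forest_sum_condensation (A : comNzRingType) n (w : edge n -> A)
    (U : {set node n}) (x y : node n) : x \notin U -> y \notin U -> x != y ->
  forest_sum w U * forest_sum w (y |: (x |: U))
  = forest_sum w (y |: U) * forest_sum w (x |: U)
    - forest_sum_to w (y |: U) y x * forest_sum_to w (x |: U) x y.
Proof.
move=> xU yU xy; set P := forest_sum w; set H := forest_sum_to w.
have yxU : y \notin x |: U by rewrite !inE negb_or eq_sym xy.
have xyU : x \notin y |: U by rewrite !inE negb_or xy.
have split v k : v \notin U -> \sum_(t in U) H (v |: U) t k = P (v |: U) - H (v |: U) v k.
  by move=> vU; rewrite /P (forest_sum_split w (v |: U) k) big_setU1 //= -/H addrC addrK.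
have out t j (V : {set node n}) : j \notin V -> t \in V ->
    H V t j = \sum_(e | src e == j) w e * H (j |: V) t (dst e).
  exact: forest_sum_to_out.
(* Apply the strong Markov property with root set x |: U and v = y at the heads
   of the edges out of x, and average. *)
transitivity (\sum_(t in U) (P (x |: U) * H (y |: U) t x + H (y |: U) y x * H (x |: U) t y)).
  rewrite {1}/P (forest_sum_split w U x) mulr_suml; apply: eq_bigr => t tU.
  rewrite -/H (out t x U) // (out t x _ xyU (setU1r y tU)) (out y x _ xyU (setU11 y U)).
  rewrite mulr_sumr !mulr_suml -big_split /=; apply: eq_bigr => e _.
  rewrite (setUCA [set x]) -mulrA /H /P (first_hitting w _ yxU (setU1r x tU)) mulrDr.
  by congr (_ + _); [rewrite mulrCA | rewrite mulrA].
rewrite big_split /= -!mulr_sumr !split //; ring.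
Qed.

(** * The theorem *)

Lemma sum_setX (A : comNzRingType) (I J : finType) (X : {set I}) (Y : {set J})
    (f : I -> A) (g : J -> A) :
  \sum_(p in setX X Y) f p.1 * g p.2 = (\sum_(i in X) f i) * (\sum_(j in Y) g j).
Proof.
rewrite big_distrlr pair_big /=; apply: eq_bigl => -[i j]; exact: in_setX.
Qed.

Lemma sum_rooted_to (A : comNzRingType) n (w : edge n -> A) (U : {set node n}) i j :
  \sum_(F in rooted_to U i j) weight_prod w F = forest_sum_to w U j i.
Proof.
under eq_bigl do rewrite inE.
rewrite big_mkcondr; apply: eq_bigr => F _.
by rewrite /reach; case: connect; rewrite ?mul1r ?mul0r.
Qed.

Theorem theorem1p0p10 (K : comNzRingType) (n : nat) (hn : (2 <= n)%N) :
  \sum_(FG in setX (rooted [set nd n 0])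
                   (rooted [set nd n 0; nd n 1; nd n 2]))
     forest_monomial K FG.1 * forest_monomial K FG.2
  = \sum_(FG in RNF n) forest_monomial K FG.1 * forest_monomial K FG.2.
Proof.
have nd_neq a b : (a <= 2)%N -> (b <= 2)%N -> a != b -> nd n a != nd n b.
  move=> a2 b2; apply: contra => /eqP/(congr1 val) /=.
  by rewrite !inordK ?ltnS ?(leq_trans a2) ?(leq_trans b2) // => ->.
have n01 := nd_neq 1%N 0%N isT isT isT; have n02 := nd_neq 2%N 0%N isT isT isT.
have n12 := nd_neq 1%N 2%N isT isT isT.
pose w : edge n -> weight_ring K n := @weight K n.
have monE : @forest_monomial K n = weight_prod w by [].
rewrite monE.
have RNF_sum : \sum_(FG in RNF n) weight_prod w FG.1 * weight_prod w FG.2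
  = forest_sum w [set nd n 0; nd n 2] * forest_sum w [set nd n 0; nd n 1]
    - forest_sum_to w [set nd n 0; nd n 2] (nd n 2) (nd n 1)
      * forest_sum_to w [set nd n 0; nd n 1] (nd n 1) (nd n 2).
  rewrite -!sum_rooted_to -!sum_setX; apply/eqP; rewrite eq_sym subr_eq addrC; apply/eqP.
  rewrite (big_setID (setX (rooted_to [set nd n 0; nd n 2] (nd n 1) (nd n 2))
    (rooted_to [set nd n 0; nd n 1] (nd n 2) (nd n 1)))) /=; congr (_ + _).
  apply: eq_bigl => FG; rewrite (setIidPr _) //.
  by apply: setXS; apply/subsetP => F; rewrite inE => /andP[].
rewrite RNF_sum sum_setX -!/(forest_sum w _).
rewrite [_ :|: [set nd n 2]]setUC ![[set nd n 0] :|: _]setUC.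
by apply: forest_sum_condensation; rewrite ?inE.
Qed.
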